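(* Let $X$ be a set, let $E$ be a $\sigma$-monotone complete partially ordered vector space, and let $\mu^*:2^X\to\overline{E^+}$ be an $\overline{E^+}$-valued outer measure. Then the set $\mathcal A$ of $\mu^*$-measurable subsets of $X$ is a $\sigma$-algebra. Furthermore, the restriction of $\mu^*$ to $\mathcal A$ is an $\overline{E^+}$-valued measure on $\mathcal A$.
   Context: All vector spaces are real. A partially ordered vector space $E$ has a proper positive cone $E^+$ (i.e. $E^+\cap(-E^+)=\{0\}$), not required to be generating. $E$ is $\sigma$-monotone complete if every increasing sequence in $E$ that is bounded from above has a supremum in $E$. Extended space: $\overline{E}=E\cup\{\infty\}$ (disjoint union), ordered by extending the order of $E$ with $x\le\infty$ for all $x\in\overline E$; $\infty+x=x+\infty=\infty$ for all $x\in\overline E$. $\overline{E^+}=E^+\cup\{\infty\}$. If $E$ is $\sigma$-monotone complete, every increasing sequence in $\overline E$ has a supremum in $\overline E$. A map $\mu^*:2^X\to\overline{E^+}$ is an $\overline{E^+}$-valued outer measure if (1) $\mu^*(\emptyset)=0$; (2) $\mu^*(\Delta_1)\le\mu^*(\Delta_2)$ whenever $\Delta_1\subseteq\Delta_2\subseteq X$; (3) $\mu^*\big(\bigcup_{n=1}^\infty\Delta_n\big)\le\bigvee_{N=1}^\infty\sum_{n=1}^N\mu^*(\Delta_n)$ in $\overline E$ for every sequence $(\Delta_n)$ of subsets of $X$. A subset $\Delta\subseteq X$ is $\mu^*$-measurable if $\mu^*(\Gamma)=\mu^*(\Gamma\cap\Delta)+\mu^*(\Gamma\cap\Delta^{\mathrm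 c})$ in $\overline E$ for all $\Gamma\subseteq X$. An $\overline{E^+}$-valued measure on an algebra $\mathcal A$ of subsets is a map $\mu:\mathcal A\to\overline{E^+}$ with $\mu(\emptyset)=0$ and $\mu\big(\bigcup_{n=1}^\infty\Delta_n\big)=\bigvee_{N=1}^\infty\sum_{n=1}^N\mu(\Delta_n)$ in $\overline E$ for every pairwise disjoint sequence $(\Delta_n)$ in $\mathcal A$ with union in $\mathcal A$. *)

(* Defs.v *)
From HB Require Import structures.
From mathcomp Require Import all_boot all_order all_algebra.
From mathcomp Require Import all_classical reals sequences measurable_structure.

Set Implicit Arguments.
Unset Strict Implicit.
Unset Printing Implicit Defensive.

Import Order.TTheory GRing.Theory Num.Theory.
Local Open Scope classical_set_scope.
Local Open Scope ring_scope.

(* Real partially ordered vector spaces; antisymmetry of the order is the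
   properness of the cone {x | 0 <= x}. *)
HB.mixin Record Lmodule_isPOrdered (R : realType) E
    of GRing.Lmodule R E & Num.POrderedZmodule E := {
  povs_leDr : forall x y z : E, x <= y -> x + z <= y + z ;
  povs_scale_ge0 : forall (a : R) (x : E), 0 <= a -> 0 <= x -> 0 <= a *: x
}.

#[short(type="porderLmodType")]
HB.structure Definition POrderedLmodule (R : realType) :=
  { E of GRing.Lmodule R E & Num.POrderedZmodule E & Lmodule_isPOrdered R E }.

Definition sigma_monotone_complete (E : porderZmodType) :=
  forall u : nat -> E,
    nondecreasing_seq u -> has_ubound (range u) -> supremums (range u) !=set0.

(* [\bar E] of constructive_ereal is not usable here: it also adjoins -oo, and
   it is ordered only when E is a numeric domain. *)
Variant withinf (E : Type) := Fin of E | Infty.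
Arguments Fin {E}.
Arguments Infty {E}.

Section WithInfChoice.
Variable E : choiceType.

Definition option_of_withinf (x : withinf E) : option E :=
  if x is Fin r then Some r else None.

Definition withinf_of_option (x : option E) : withinf E :=
  if x is Some r then Fin r else Infty.

Lemma option_of_withinfK : cancel option_of_withinf withinf_of_option.
Proof. by case. Qed.

HB.instance Definition _ :=
  Choice.copy (withinf E) (can_type option_of_withinfK).

End WithInfChoice.

Section WithInfOrder.
Variable E : porderZmodType.

Definition le_withinf (x y : withinf E) : bool :=
  match x, y with
  | _, Infty => true
  | Infty, Fin _ => false
  | Fin r, Fin s => r <= s
  end.

Lemma le_withinf_refl : reflexive le_withinf.
Proof. by case=> /=. Qed.

Lemma le_withinf_anti : antisymmetric le_withinf.
Proof. by case=> [r|] [s|] //= /le_anti ->. Qed.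

Lemma le_withinf_trans : transitive le_withinf.
Proof. by case=> [r|] [s|] [t|] //=; apply: le_trans. Qed.

HB.instance Definition _ := Order.Le_isPOrder.Build ring_display (withinf E)
  le_withinf_refl le_withinf_anti le_withinf_trans.

End WithInfOrder.

Section WithInfAdd.
Variable E : nmodType.

Definition add_withinf (x y : withinf E) : withinf E :=
  if x is Fin r then if y is Fin s then Fin (r + s) else Infty else Infty.

Lemma add_withinfA : associative add_withinf.
Proof. by case=> [r|] [s|] [t|] //=; rewrite addrA. Qed.

Lemma add_withinfC : commutative add_withinf.
Proof. by case=> [r|] [s|] //=; rewrite addrC. Qed.

Lemma add0_withinf : left_id (Fin 0) add_withinf.
Proof. by case=> [r|] //=; rewrite add0r. Qed.

HB.instance Definition _ := GRing.isNmodule.Build (withinf E)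
  add_withinfA add_withinfC add0_withinf.

End WithInfAdd.

(* The default value [Infty] plays no role for increasing sequences when E is
   sigma-monotone complete: they have a supremum, by [seq_supP]. *)
Definition seq_sup (E : porderZmodType) (u : nat -> withinf E) : withinf E :=
  supremum Infty (range u).

Lemma seq_supP (E : porderZmodType) (u : nat -> withinf E) :
  sigma_monotone_complete E -> nondecreasing_seq u ->
  supremums (range u) (seq_sup u).
Proof.
move=> hE ndu; rewrite /seq_sup /supremum ifF; last first.
  by apply/negbTE/set0P; exists (u 0%N); exact: imageT.
suff [s us] : supremums (range u) !=set0 by exact: (xgetI Infty us).
have [[b bu]|nb] := pselect (exists b : E, ubound (range u) (Fin b)); last first.
  exists Infty; split=> [x _|]; first by case: x.
  by case=> [b ub|//]; case: nb; exists b.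
pose v n : E := if u n is Fin r then r else b.
have uv n : u n = Fin (v n).
  by rewrite /v; have := bu _ (imageT u n); case: (u n).
have [] := hE v.
- by move=> m n mn; have : (u m <= u n)%O := ndu _ _ mn; rewrite !uv.
- exists b => _ [n _ <-].
  by have : (u n <= Fin b)%O := bu _ (imageT u n); rewrite uv.
move=> s [vs sv]; exists (Fin s); split=> [_ [n _ <-]|].
  by rewrite uv; exact: (vs _ (imageT v n)).
case=> [c uc|//]; apply: sv => _ [n _ <-].
by have : (u n <= Fin c)%O := uc _ (imageT u n); rewrite uv.
Qed.

(* [series_sup F] is the supremum over N >= 1 of F 0 + ... + F (N - 1). *)
Definition series_sup (E : porderZmodType) (F : nat -> withinf E) : withinf E :=
  seq_sup (fun N => \sum_(n < N.+1) F n).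

(* In the next two records, [0 <= _] says that the values lie in the positive
   cone of E or are infinite. *)
Record is_outer_measure (E : porderZmodType) (X : Type)
    (mu : set X -> withinf E) : Prop := IsOuterMeasure {
  is_outer_measure_ge0 : forall D, (0 : withinf E) <= mu D ;
  is_outer_measure_set0 : mu set0 = 0 ;
  is_outer_measure_le : forall D1 D2, D1 `<=` D2 -> mu D1 <= mu D2 ;
  is_outer_measure_bigcup : forall D : nat -> set X,
    mu (\bigcup_n D n) <= series_sup (mu \o D)
}.

Definition outer_measurable (E : porderZmodType) (X : Type)
    (mu : set X -> withinf E) : set (set X) :=
  [set D | forall G, mu G = mu (G `&` D) + mu (G `&` ~` D)].

(* For an algebra of sets [A], only the values of [mu] on [A] matter, so that
   this is a property of the restriction of [mu] to [A]. *)
Record is_measure_on (E : porderZmodType) (X : Type)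
    (A : set (set X)) (mu : set X -> withinf E) : Prop := IsMeasureOn {
  is_measure_on_ge0 : forall D, A D -> (0 : withinf E) <= mu D ;
  is_measure_on_set0 : mu set0 = 0 ;
  is_measure_on_bigcup : forall D : nat -> set X,
    (forall n, A (D n)) -> trivIset setT D -> A (\bigcup_n D n) ->
    mu (\bigcup_n D n) = series_sup (mu \o D)
}.

(* Main.v *)
Require Import Defs.
From mathcomp Require Import all_boot all_order all_algebra.
From mathcomp Require Import all_classical reals sequences measurable_structure.

(** Carathéodory's argument survives the loss of a total order on the values
    because subtraction is only ever needed for finite values.

    Splitting a test set G successively along disjoint measurable sets
    [D 0], [D 1], ... writes [mu G] as a partial sum of the [mu (G `&` D n)]
    plus the measure of the part of G missed so far
    ([outer_measurable_split_sum]).  By monotonicity that part may be replaced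
    by the part of G outside the whole union.  The resulting bound is uniform
    in the number of terms, and it passes to the supremum because translation
    by a finite value is an order automorphism of E ([seq_sup_addr_le]); this
    gives the master inequality [series_sup_split_le],

      sum_n mu (G `&` D n)  +  mu (G `\` \bigcup_n D n)  <=  mu G.

    Countable subadditivity turns it into measurability of the union, and its
    instance where G is the union itself into countable additivity.  Measurable
    sets thus form a Dynkin system; they are also stable under binary
    intersection, for purely additive reasons, hence form a sigma-algebra. *)

Set Implicit Arguments.
Unset Strict Implicit.
Unset Printing Implicit Defensive.

Import Order.TTheory GRing.Theory Num.Theory.
Local Open Scope classical_set_scope.
Local Open Scope ring_scope.

Lemma withinf_leD2r (R : realType) (E : porderLmodType R)
    (z x y : withinf E) : x <= y -> x + z <= y + z.
Proof.
by case: x y z => [x|] [y|] [z|] //= xy; apply: (povs_leDr x y z xy).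
Qed.

Lemma withinf_leDl (R : realType) (E : porderLmodType R)
    (x z : withinf E) : (0 : withinf E) <= z -> x <= x + z.
Proof. by move=> z0; rewrite -{1}[x]add0r [x + z]addrC withinf_leD2r. Qed.

Lemma nondecreasing_partial_sums (R : realType) (E : porderLmodType R)
    (F : nat -> withinf E) :
  (forall n, (0 : withinf E) <= F n) ->
  nondecreasing_seq (fun N => \sum_(n < N.+1) F n).
Proof.
move=> F0; apply/nondecreasing_seqP => N.
by rewrite [leRHS]big_ord_recr withinf_leDl.
Qed.

Lemma seq_sup_le (E : porderZmodType) (u : nat -> withinf E) (b : withinf E) :
  sigma_monotone_complete E -> nondecreasing_seq u ->
  (forall n, u n <= b) -> seq_sup u <= b.
Proof.
by move=> hE ndu ub; apply: (seq_supP hE ndu).2 => _ [n _ <-]; exact: ub.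
Qed.

(** If g is infinite there is nothing to prove; otherwise c is finite,
    as [u 0 + c] is, and can be subtracted: [g - c] bounds the sequence. *)
Lemma seq_sup_addr_le (R : realType) (E : porderLmodType R)
    (u : nat -> withinf E) (c g : withinf E) :
  sigma_monotone_complete E -> nondecreasing_seq u ->
  (forall n, u n + c <= g) -> seq_sup u + c <= g.
Proof.
move=> hE ndu; case: g => [g|]; last by case: (_ + c).
case: c => [c|] ucg; last by have := ucg 0%N; case: (u 0%N).
have FinD (x y : E) : (Fin x + Fin y : withinf E) = Fin (x + y) by [].
suff : seq_sup u <= Fin (g - c).
  by move=> /(withinf_leD2r (Fin c)); rewrite FinD subrK.
apply: seq_sup_le => // n; have := withinf_leD2r (Fin (- c)) (ucg n).
by rewrite -addrA !FinD subrr addr0.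
Qed.

(** Countable subadditivity for the sequence A, B, set0, set0, ..., whose
    partial sums never exceed [mu A + mu B]. *)
Lemma outer_measure_setU_le (R : realType) (E : porderLmodType R) (X : Type)
    (mu : set X -> withinf E) (A B : set X) :
  sigma_monotone_complete E -> is_outer_measure mu ->
  mu (A `|` B) <= mu A + mu B.
Proof.
move=> hE [mu0 mus0 _ muU]; rewrite -bigcup2E.
apply: le_trans (muU _) _; apply: seq_sup_le => //.
  by apply: nondecreasing_partial_sums => n; exact: mu0.
case=> [|N]; first by rewrite big_ord1 withinf_leDl.
by rewrite !big_ord_recl big1 ?addr0.
Qed.

Lemma outer_measurable_ge (R : realType) (E : porderLmodType R) (X : Type)
    (mu : set X -> withinf E) (D : set X) :
  sigma_monotone_complete E -> is_outer_measure mu ->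
  (forall G, mu (G `&` D) + mu (G `&` ~` D) <= mu G) ->
  outer_measurable mu D.
Proof.
move=> hE hmu geD G; apply/le_anti/andP; split; last exact: geD.
rewrite -{1}(setUIDK G D) setDE.
exact: outer_measure_setU_le.
Qed.

Lemma outer_measurableT (E : porderZmodType) (X : Type)
    (mu : set X -> withinf E) :
  mu set0 = 0 -> outer_measurable mu setT.
Proof. by move=> mu0 G; rewrite setIT setCT setI0 mu0 addr0. Qed.

Lemma outer_measurableC (E : porderZmodType) (X : Type)
    (mu : set X -> withinf E) (D : set X) :
  outer_measurable mu D -> outer_measurable mu (~` D).
Proof. by move=> mD G; rewrite setCK addrC. Qed.

(** Both sides reduce to the sum of [mu] over the three pieces [G `&` A `&` B],
    [G `&` A `&` ~` B] and [G `&` ~` A]. *)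
Lemma outer_measurableI (E : porderZmodType) (X : Type)
    (mu : set X -> withinf E) (A B : set X) :
  outer_measurable mu A -> outer_measurable mu B ->
  outer_measurable mu (A `&` B).
Proof.
move=> mA mB G; rewrite (mA G) (mB (G `&` A)) (mA (G `&` ~` (A `&` B))).
have -> : G `&` ~` (A `&` B) `&` A = G `&` A `&` ~` B.
  by rewrite setIAC -setIA setCI setIUr setICr set0U setIA.
have -> : G `&` ~` (A `&` B) `&` ~` A = G `&` ~` A.
  by rewrite -setIA setCI setIUl setIid setUidl.
by rewrite addrA setIA.
Qed.

(** The part of G left over after N steps is split along [D N], which by
    disjointness meets it in all of [G `&` D N]. *)
Lemma outer_measurable_split_sum (E : porderZmodType) (X : Type)
    (mu : set X -> withinf E) (D : nat -> set X) (G : set X) (N : nat) :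
  (forall n, outer_measurable mu (D n)) -> trivIset setT D ->
  mu G = \sum_(n < N) mu (G `&` D n) + mu (G `&` ~` \bigcup_(n < N) D n).
Proof.
move=> mD tD; elim: N => [|N IHN].
  by rewrite big_ord0 add0r bigcup_mkord big_ord0 setC0 setIT.
rewrite big_ord_recr /= {1}IHN (mD N (G `&` _)) addrA.
congr (_ + mu _ + mu _).
  rewrite setIAC; apply/setIidPl => x [_ DNx] [n /= nN Dnx].
  by move: nN; rewrite (tD n N I I) ?ltnn //; exists x.
by rewrite !bigcup_mkord big_ord_recr /= setCU setIA.
Qed.

Lemma series_sup_split_le (R : realType) (E : porderLmodType R) (X : Type)
    (mu : set X -> withinf E) (D : nat -> set X) (G : set X) :
  sigma_monotone_complete E -> is_outer_measure mu ->
  (forall n, outer_measurable mu (D n)) -> trivIset setT D ->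
  series_sup (fun n => mu (G `&` D n)) + mu (G `&` ~` \bigcup_n D n) <= mu G.
Proof.
move=> hE [mu0 _ le_mu _] mD tD; apply: seq_sup_addr_le => //.
  exact: (nondecreasing_partial_sums (F := fun n => mu (G `&` D n))).
move=> N; rewrite [leRHS](outer_measurable_split_sum _ N.+1 mD tD).
rewrite ![\sum_(_ < _) _ + _]addrC; apply/withinf_leD2r/le_mu.
by apply: setIS; apply: subsetC => x [n _ Dnx]; exists n.
Qed.

Lemma outer_measurable_bigcup (R : realType) (E : porderLmodType R)
    (X : Type) (mu : set X -> withinf E) (D : nat -> set X) :
  sigma_monotone_complete E -> is_outer_measure mu ->
  (forall n, outer_measurable mu (D n)) -> trivIset setT D ->
  outer_measurable mu (\bigcup_n D n).
Proof.
move=> hE hmu mD tD; apply: outer_measurable_ge => // G.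
apply: le_trans (series_sup_split_le G hE hmu mD tD).
by rewrite setI_bigcupr withinf_leD2r// is_outer_measure_bigcup.
Qed.

Lemma outer_measure_bigcup (R : realType) (E : porderLmodType R)
    (X : Type) (mu : set X -> withinf E) (D : nat -> set X) :
  sigma_monotone_complete E -> is_outer_measure mu ->
  (forall n, outer_measurable mu (D n)) -> trivIset setT D ->
  mu (\bigcup_n D n) = series_sup (mu \o D).
Proof.
move=> hE hmu mD tD; apply/le_anti/andP; split.
  exact: is_outer_measure_bigcup.
have := series_sup_split_le (\bigcup_n D n) hE hmu mD tD.
rewrite setICr (is_outer_measure_set0 hmu) addr0.
suff -> : (fun n => mu ((\bigcup_n D n) `&` D n)) = mu \o D by [].
by apply/funext => n /=; congr mu; apply/setIidPr/bigcup_sup.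
Qed.

Theorem theorem5p5 (R : realType) (E : porderLmodType R) (X : Type)
    (mu : set X -> withinf E)
    (hE : sigma_monotone_complete E)
    (hmu : is_outer_measure mu) :
  sigma_algebra setT (outer_measurable mu) /\
  is_measure_on (outer_measurable mu) mu.
Proof.
have mu0 := is_outer_measure_set0 hmu; split.
  apply: dynkin_setI_sigma_algebra; last exact: outer_measurableI.
  split; first exact: outer_measurableT.
    exact: outer_measurableC.
  by move=> D tD mD; apply: outer_measurable_bigcup.
split=> // [D _|D mD tD _]; first exact: is_outer_measure_ge0.
exact: outer_measure_bigcup.
Qed.
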